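(* Let $H$ be a finite set, let $p_h\in[0,1]$ for each $h\in H$, and let $\mathcal{H}$ be the set of all subsets of $H$. If $f,g:\mathcal{H}\to\mathbb{R}$ are increasing functions, then the function $f\star g:\mathcal{H}\to\mathbb{R}$ is increasing, where $f\star g(S)=\sum_{S_1,S_2\subseteq H} f(S_1)\,g(S_2)\,\mu_S(S_1,S_2)$ for $S\subseteq H$.
   Context: A function $f:\mathcal{H}\to\mathbb{R}$ is called increasing if $S\supseteq T$ implies $f(S)\ge f(T)$. For $X,Y\subseteq H$ put $P(X,Y)=\prod_{h\in X\cap Y}p_h\prod_{h\in X\setminus Y}(1-p_h)$. For $S\subseteq H$, $\mu_S$ is the probability measure on $\mathcal{H}\times\mathcal{H}$ given by $\mu_S(S_1,S_2)=0$ if $S\cap S_1\neq S\cap S_2$, and otherwise $\mu_S(S_1,S_2)=P(S,S_1)\,P(H\setminus S,S_1)\,P(H\setminus S,S_2)$. Equivalently, $\mu_S(S_1,S_2)$ is the probability that the following random procedure produces $(S_1,S_2)$: for each $h\in S$, independently, with probability $p_h$ include $h$ in both $S_1$ and $S_2$, and otherwise exclude it from both; for each $h\in H\setminus S$, independently decide with probability $p_h$ whether to include $h$ in $S_1$ and, independently again with probability $p_h$, whether to include $h$ in $S_2$. *)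

(* Defs.v *)
From mathcomp Require Import all_boot all_order all_algebra.
From mathcomp Require Import reals.

Set Implicit Arguments.
Unset Strict Implicit.
Unset Printing Implicit Defensive.

Import Order.TTheory GRing.Theory Num.Theory.
Local Open Scope ring_scope.

Definition increasing (R : realType) (H : finType) (f : {set H} -> R) : Prop :=
  forall S T : {set H}, T \subset S -> f T <= f S.

Definition prob (R : realType) (H : finType) (p : H -> R) (X Y : {set H}) : R :=
  (\prod_(h in X :&: Y) p h) * (\prod_(h in X :\: Y) (1 - p h)).

(* The point mass at (S1, S2) of the law of two p-random subsets of H that
   coincide on S and are independent off S. *)
Definition mu (R : realType) (H : finType) (p : H -> R)
    (S S1 S2 : {set H}) : R :=
  if S :&: S1 != S :&: S2 then 0
  else prob p S S1 * prob p (~: S) S1 * prob p (~: S) S2.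

Definition star (R : realType) (H : finType) (p : H -> R)
    (f g : {set H} -> R) (S : {set H}) : R :=
  \sum_(S1 : {set H}) \sum_(S2 : {set H}) f S1 * g S2 * mu p S S1 S2.

(* Main.v *)
(** Both measures in question are products over the points of [H], so
    [mu (h |: S) - mu S] differs from a nonnegative product weight over the
    points [k != h] only by the factor [p h * (1 - p h)] with sign [+] if [h]
    lies in both or neither of [S1], [S2], and [-] otherwise.  Grouping the
    four terms that differ only at [h] gives
    [(f (h |: S1) - f S1) * (g (h |: S2) - g S2)], which is nonnegative
    termwise. *)
Require Import Defs.
From mathcomp Require Import all_boot all_order all_algebra.
From mathcomp Require Import ring.
From mathcomp Require Import reals.

Import Order.TTheory GRing.Theory Num.Theory.
Local Open Scope ring_scope.

(** Reduces monotonicity to adding a single point: with [S] fixed, [T] grows to [S] by one point of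
    [S :\: T] at a time, by induction on a bound for [#|S :\: T|]. *)
Lemma increasing_setU1 {R : realType} {H : finType} (f : {set H} -> R) :
  (forall (S : {set H}) (h : H), h \notin S -> f S <= f (h |: S)) ->
  increasing f.
Proof.
move=> fU1 S T; move: {2}#|S :\: T| (leqnn #|S :\: T|) => n.
elim: n T => [|n IHn] T leST sTS.
  move: leST; rewrite leqn0 cards_eq0 setD_eq0 => sST.
  by have -> : T = S by apply/eqP; rewrite eqEsubset sTS.
have [STeq0|[h]] := set_0Vmem (S :\: T).
  by apply: IHn; rewrite // STeq0 cards0.
rewrite inE => /andP[hT hS]; apply: le_trans (fU1 _ _ hT) _.
apply: IHn; last by rewrite subUset sub1set hS.
have -> : S :\: (h |: T) = (S :\: T) :\ h.
  by apply/setP => x; rewrite !inE negb_or andbA.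
by move: leST; rewrite (cardsD1 h) !inE hT hS.
Qed.

Lemma sum_setU1 {V : zmodType} {H : finType} (h : H) (F : {set H} -> V) :
  \sum_X F X = \sum_(X : {set H} | h \notin X) (F (h |: X) + F X).
Proof.
rewrite (bigID (fun X : {set H} => h \in X)) big_split /=; congr (_ + _).
(* The inverse condition [(h |: X) :\ h == X] of this reindexing is exactly [h \notin X]. *)
rewrite (reindex_onto (fun X => h |: X) (fun X => X :\ h)) /=; last first.
  by move=> X; apply: setD1K.
apply: eq_bigl => X; rewrite setU11 /=.
apply/eqP/idP => [<-|hX]; first by rewrite setD11.
exact: setU1K.
Qed.

Definition bern {R : realType} {H : finType} (p : H -> R) (h : H) (a : bool) : R :=
  if a then p h else 1 - p h.

(** The joint law of the two membership bits at one point; for [h \in S], the boolean multiplicity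
    kills the mass when the bits disagree. *)
Definition coord {R : realType} {H : finType} (p : H -> R)
    (S S1 S2 : {set H}) (h : H) : R :=
  if h \in S then bern p h (h \in S1) *+ ((h \in S1) == (h \in S2))
  else bern p h (h \in S1) * bern p h (h \in S2).

Lemma probE {R : realType} {H : finType} (p : H -> R) (X Y : {set H}) :
  prob p X Y = \prod_(h in X) bern p h (h \in Y).
Proof.
rewrite (big_setID Y) /prob /=; congr (_ * _); apply: eq_bigr => h; rewrite inE.
  by case/andP=> _ ->.
by case/andP=> /negbTE ->.
Qed.

Lemma muE {R : realType} {H : finType} (p : H -> R) (S S1 S2 : {set H}) :
  mu p S S1 S2 = \prod_h coord p S S1 S2 h.
Proof.
rewrite /mu; case: eqP => [eqS|neS] /=.
  rewrite !probE [RHS](bigID (mem S)) /= -mulrA -big_split; congr (_ * _).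
    apply: eq_bigr => h hS; rewrite /coord hS.
    by move/setP/(_ h): eqS; rewrite !inE hS /= => ->; rewrite eqxx.
  by apply: eq_big => [h|h]; rewrite inE // => /negbTE hS; rewrite /coord hS.
(* A point of [S] where [S1] and [S2] disagree contributes a zero factor. *)
have /existsP[h] : [exists h, (h \in S) && ((h \in S1) != (h \in S2))].
  apply: contra_notT neS; rewrite negb_exists => /forallP eqS; apply/setP => h.
  by move: (eqS h); rewrite !inE; case: (h \in S) => //= /negbNE/eqP.
case/andP=> hS /negbTE ne12.
by rewrite (bigD1 h) //= /coord hS ne12 mulr0n mul0r.
Qed.

Lemma coord_ge0 {R : realType} {H : finType} (p : H -> R) (S S1 S2 : {set H}) h :
  0 <= p h <= 1 -> 0 <= coord p S S1 S2 h.
Proof.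
case/andP=> p0 p1; have b0 a : 0 <= bern p h a by case: a; rewrite //= subr_ge0.
by rewrite /coord; case: ifP => _; rewrite ?mulrn_wge0 ?mulr_ge0.
Qed.

Definition weight {R : realType} {H : finType} (p : H -> R)
    (S : {set H}) (h : H) (S1 S2 : {set H}) : R :=
  \prod_(k | k != h) coord p S S1 S2 k.

(** The factor at [h] is omitted, so membership of [h] in any of the three sets is irrelevant. *)
Lemma eq_weight {R : realType} {H : finType} (p : H -> R) (h : H)
    (S S' S1 S1' S2 S2' : {set H}) :
  S :\ h = S' :\ h -> S1 :\ h = S1' :\ h -> S2 :\ h = S2' :\ h ->
  weight p S h S1 S2 = weight p S' h S1' S2'.
Proof.
move=> /setP eS /setP e1 /setP e2; apply: eq_bigr => k kh.
move: (eS k) (e1 k) (e2 k); rewrite !inE kh /= => eSk e1k e2k.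
by rewrite /coord eSk e1k e2k.
Qed.

Lemma setU1D1 {H : finType} (h : H) (X : {set H}) : (h |: X) :\ h = X :\ h.
Proof. by apply/setP => k; rewrite !inE; case: eqP. Qed.

Lemma mu_setU1B {R : realType} {H : finType} (p : H -> R)
    (S S1 S2 : {set H}) (h : H) : h \notin S ->
  mu p (h |: S) S1 S2 - mu p S S1 S2 =
  (-1) ^+ ((h \in S1) != (h \in S2)) * (p h * (1 - p h)) * weight p S h S1 S2.
Proof.
move=> /negbTE hS; rewrite !muE !(bigD1 (P := predT) h) //=.
rewrite -!/(weight _ _ _ _ _) (eq_weight p h _ S _ S1 _ S2) ?setU1D1 //.
rewrite /coord setU11 hS /bern.
(* With [q = p h], the differences at [h] are [q - q^2], [(1 - q) - (1 - q)^2] and, for differing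
   bits, [0 - q * (1 - q)]. *)
by case: (h \in S1); case: (h \in S2) => /=; rewrite ?mulr0n ?mulr1n; ring.
Qed.

Lemma star_setU1B {R : realType} {H : finType} (p : H -> R)
    (f g : {set H} -> R) (S : {set H}) (h : H) : h \notin S ->
  star p f g (h |: S) - star p f g S =
  \sum_(S1 : {set H} | h \notin S1) \sum_(S2 : {set H} | h \notin S2)
    p h * (1 - p h) * weight p S h S1 S2 *
    ((f (h |: S1) - f S1) * (g (h |: S2) - g S2)).
Proof.
move=> hS; rewrite /star -sumrB (sum_setU1 h).
apply: eq_bigr => S1 /negbTE hS1; rewrite -!sumrB -big_split /= (sum_setU1 h).
apply: eq_bigr => S2 /negbTE hS2; rewrite -!mulrBr !mu_setU1B // !setU11 hS1 hS2.
(* All four terms now get the same weight, so their signs [+], [-], [-], [+] factor into a product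
   of two increments. *)
rewrite (eq_weight p h S S (h |: S1) S1 (h |: S2) S2) ?setU1D1 //.
rewrite (eq_weight p h S S (h |: S1) S1 S2 S2) ?setU1D1 //.
rewrite (eq_weight p h S S S1 S1 (h |: S2) S2) ?setU1D1 //=.
by ring.
Qed.

Theorem theorem11 (R : realType) (H : finType) (p : H -> R)
    (hp : forall h : H, 0 <= p h <= 1) (f g : {set H} -> R)
    (hf : increasing f) (hg : increasing g) :
  increasing (star p f g).
Proof.
apply: increasing_setU1 => S h hS; rewrite -subr_ge0 star_setU1B //.
have /andP[p0 p1] := hp h.
apply: sumr_ge0 => S1 _; apply: sumr_ge0 => S2 _.
rewrite !mulr_ge0 ?subr_ge0 ?hf ?hg ?subsetUr //.
by apply: prodr_ge0 => k _; apply: coord_ge0.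
Qed.
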